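(* Let $\mathcal M=\mathbb R\times\mathcal N$ with structure $(\phi,\xi,\eta,g^L)$ be the Sasakian lift of a Kähler manifold $(\mathcal N,J,g)$ with Kähler form $\omega=d\tau$, and let $V$ be an infinitesimal automorphism of the Kähler structure of $\mathcal N$. Then its lift $V^L$ satisfies $$\mathcal L_{V^L}\phi=2\alpha\otimes\xi,\qquad \mathcal L_{V^L}g^L=4\alpha^\phi\odot\eta,\qquad \mathcal L_{V^L}\Phi=0,$$ where $\alpha(\cdot)=g^L(V^L,\cdot)$ and $\alpha^\phi(\cdot)=\alpha(\phi\,\cdot)=-g^L(\phi V^L,\cdot)$, and the form $\alpha^\phi$ is closed, $d\alpha^\phi=0$.
   Context: Conventions: $2\,d\theta(X,Y)=X\theta(Y)-Y\theta(X)-\theta([X,Y])$ for a 1-form $\theta$; $\odot$ is the symmetric tensor product, $\theta\odot\eta=\tfrac12(\theta\otimes\eta+\eta\otimes\theta)$; $(\alpha\otimes\xi)(Y)=\alpha(Y)\xi$. On a Kähler manifold $(\mathcal N,J,g)$, $\dim\mathcal N=2n$, the Kähler form is $\omega(X,Y)=g(X,JY)$; it is assumed that there is a global 1-form $\tau$ with $\omega=d\tau$. A vector field $V$ is an infinitesimal automorphism of the Kähler structure if two, equivalently all three, of $\mathcal L_VJ=0$, $\mathcal L_Vg=0$, $\mathcal L_V\omega=0$ hold. Sasakian lift: $\mathcal M=\mathbb R\times\mathcal N$ with projection $\pi_2:\mathcal M\to\mathcal N$ and coordinate $t$ on $\mathbb R$; $\xi=\partial_t$, $\eta=dt+\pi_2^*\tau$.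 A vector field $X$ on $\mathcal N$ is lifted to $X^L=X-(\tau(X)\circ\pi_2)\,\xi$ on $\mathcal M$. The $(1,1)$-tensor $\phi$ and metric $g^L$ are determined by $\phi X^L=(JX)^L$, $\phi\xi=0$, $g^L=\eta\otimes\eta+\pi_2^*g$. The fundamental form is $\Phi(\cdot,\cdot)=g^L(\cdot,\phi\,\cdot)$. *)

(* Defs.v *)
From HB Require Import structures.
From mathcomp Require Import all_boot all_order all_algebra.
From mathcomp Require Import all_classical all_reals all_analysis.
Import Order.TTheory GRing.Theory Num.Theory.
Import numFieldNormedType.Exports.

Set Implicit Arguments.
Unset Strict Implicit.
Unset Printing Implicit Defensive.

Local Open Scope classical_set_scope.
Local Open Scope ring_scope.

(* Manifolds carry a preferred chart around each of their points, and the
   tangent space at p is the model space 'rV[R]_(mdim M), read in the preferred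
   chart at p.  Tensors at p are matrices in that frame; tangent vectors are
   rows, and linear maps act on them from the right. *)

Section Smoothness.
Context {R : realType} {E F : normedModType R}.

Fixpoint Ck_on (k : nat) (U : set E) (f : E -> F) : Prop :=
  if k is k'.+1 then
    (forall x, U x -> differentiable f x) /\
    (forall v, Ck_on k' U (fun x => 'd f x v))
  else forall x, U x -> {for x, continuous f}.

Definition smooth_on (U : set E) (f : E -> F) := forall k, Ck_on k U f.

Definition smooth_near (x : E) (f : E -> F) :=
  exists U, open_nbhs x U /\ smooth_on U f.

End Smoothness.

Record charted (R : realType) := Charted {
  carrier :> topologicalType;
  mdim : nat;
  chart_dom : carrier -> set carrier;
  chart : carrier -> carrier -> 'rV[R]_mdim;
  chart_inv : carrier -> 'rV[R]_mdim -> carrier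
}.

Record is_manifold (R : realType) (M : charted R) : Prop := IsManifold {
  _ : hausdorff_space M;
  _ : @second_countable M;
  _ : forall p : M, chart_dom p p;
  _ : forall p : M, open (chart_dom p);
  _ : forall p : M, open (chart p @` chart_dom p);
  _ : forall p q : M, chart_dom p q -> chart_inv p (chart p q) = q;
  _ : forall p q : M, chart_dom p q -> {for q, continuous (chart p)};
  _ : forall p q : M, chart_dom p q ->
        {for chart p q, continuous (chart_inv p)};
  _ : forall p q : M,
        smooth_on (chart p @` (chart_dom p `&` chart_dom q))
                  (chart q \o chart_inv p)
}.

Section Tensors.
Context {R : realType} (M : charted R).

Definition vfield := M -> 'rV[R]_(mdim M).
Definition form1 := M -> 'cV[R]_(mdim M).
Definition endo := M -> 'M[R]_(mdim M).
Definition form2 := M -> 'M[R]_(mdim M).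

Definition ap1 (theta : form1) (X : vfield) : M -> R :=
  fun p => (X p *m theta p) 0 0.
Definition apE (T : endo) (X : vfield) : vfield := fun p => X p *m T p.
Definition ap2 (h : form2) (X Y : vfield) : M -> R :=
  fun p => (X p *m h p *m (Y p)^T) 0 0.

(* theta (x) X : Y |-> theta(Y) X *)
Definition otimes (theta : form1) (X : vfield) : endo :=
  fun p => theta p *m X p.
Definition odot (theta eta : form1) : form2 :=
  fun p => 2^-1 *: (theta p *m (eta p)^T + eta p *m (theta p)^T).
Definition vcontract (h : form2) (X : vfield) : form1 :=
  fun p => (X p *m h p)^T.
Definition comp1E (theta : form1) (T : endo) : form1 :=
  fun p => T p *m theta p.
(* h(., T .), in row-vector convention *)
Definition comp2E (h : form2) (T : endo) : form2 :=
  fun p => h p *m (T p)^T.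

(* Derivative at r of the change of coordinates from chart p to chart q. *)
Definition transJ (p q r : M) : 'M[R]_(mdim M) :=
  'J (chart q \o chart_inv p) (chart p r).

(* Coordinate expressions in chart p, as functions on the model space. *)
Definition rep_vf (p : M) (X : vfield) (x : 'rV[R]_(mdim M)) :=
  let q := chart_inv p x in X q *m transJ q p q.
Definition rep_f1 (p : M) (theta : form1) (x : 'rV[R]_(mdim M)) :=
  let q := chart_inv p x in transJ p q q *m theta q.
Definition rep_endo (p : M) (T : endo) (x : 'rV[R]_(mdim M)) :=
  let q := chart_inv p x in transJ p q q *m T q *m transJ q p q.
Definition rep_f2 (p : M) (h : form2) (x : 'rV[R]_(mdim M)) :=
  let q := chart_inv p x in transJ p q q *m h q *m (transJ p q q)^T.

Definition vf_smooth_near (p : M) (X : vfield) :=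
  smooth_near (chart p p) (rep_vf p X).
Definition vf_smooth (X : vfield) := forall p, vf_smooth_near p X.
Definition f1_smooth (theta : form1) :=
  forall p, smooth_near (chart p p) (rep_f1 p theta).
Definition endo_smooth (T : endo) :=
  forall p, smooth_near (chart p p) (rep_endo p T).
Definition f2_smooth (h : form2) :=
  forall p, smooth_near (chart p p) (rep_f2 p h).

Definition dirder (X : vfield) (f : M -> R) : M -> R :=
  fun p => 'd (f \o chart_inv p) (chart p p) (X p).

Definition bracket (X Y : vfield) : vfield := fun p =>
  'd (rep_vf p Y) (chart p p) (X p) - 'd (rep_vf p X) (chart p p) (Y p).

(* (L_V T)(Y) *)
Definition lieE (V : vfield) (T : endo) (Y : vfield) : vfield :=
  fun p => bracket V (apE T Y) p - apE T (bracket V Y) p.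

(* (L_V h)(X,Y) *)
Definition lie2 (V : vfield) (h : form2) (X Y : vfield) : M -> R :=
  fun p => dirder V (ap2 h X Y) p
           - ap2 h (bracket V X) Y p - ap2 h X (bracket V Y) p.

(* d theta(X,Y), normalized by 2 d theta(X,Y) = X theta(Y) - ... *)
Definition extd1 (theta : form1) (X Y : vfield) : M -> R :=
  fun p => 2^-1 * (dirder X (ap1 theta Y) p - dirder Y (ap1 theta X) p
                   - ap1 theta (bracket X Y) p).

(* d omega(X,Y,Z), normalized accordingly *)
Definition extd2 (omega : form2) (X Y Z : vfield) : M -> R :=
  fun p => 3^-1 *
    (dirder X (ap2 omega Y Z) p + dirder Y (ap2 omega Z X) p
     + dirder Z (ap2 omega X Y) p
     - ap2 omega (bracket X Y) Z p - ap2 omega (bracket Y Z) X p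
     - ap2 omega (bracket Z X) Y p).

(* Equalities of tensor fields whose left-hand side is given by its values on
   vector fields: both sides are compared at each point p on all vector fields
   that are smooth in a neighbourhood of p. *)
Definition lieE_eq (V : vfield) (T S : endo) :=
  forall p Y, vf_smooth_near p Y -> lieE V T Y p = apE S Y p.
Definition lie2_eq (V : vfield) (h k : form2) :=
  forall p X Y, vf_smooth_near p X -> vf_smooth_near p Y ->
    lie2 V h X Y p = ap2 k X Y p.
Definition extd1_eq (theta : form1) (omega : form2) :=
  forall p X Y, vf_smooth_near p X -> vf_smooth_near p Y ->
    extd1 theta X Y p = ap2 omega X Y p.
Definition closed2 (omega : form2) :=
  forall p X Y Z, vf_smooth_near p X -> vf_smooth_near p Y ->
    vf_smooth_near p Z -> extd2 omega X Y Z p = 0.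

Definition integrable_acs (J : endo) :=
  forall p X Y, vf_smooth_near p X -> vf_smooth_near p Y ->
    bracket (apE J X) (apE J Y) p - apE J (bracket (apE J X) Y) p
    - apE J (bracket X (apE J Y)) p - bracket X Y p = 0.

Record is_kahler (J : endo) (g : form2) : Prop := IsKahler {
  _ : endo_smooth J;
  _ : f2_smooth g;
  _ : forall p, J p *m J p = - 1%:M;
  _ : integrable_acs J;
  _ : forall p, (g p)^T = g p;
  _ : forall p (v : 'rV[R]_(mdim M)), v != 0 -> 0 < (v *m g p *m v^T) 0 0;
  _ : forall p, J p *m g p *m (J p)^T = g p;
  _ : closed2 (comp2E g J)
}.

(* At least two of the three invariance conditions. *)
Definition inf_automorphism (J : endo) (g : form2) (V : vfield) :=
  let LJ := lieE_eq V J (fun=> 0) in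
  let Lg := lie2_eq V g (fun=> 0) in
  let Lw := lie2_eq V (comp2E g J) (fun=> 0) in
  [\/ LJ /\ Lg, LJ /\ Lw | Lg /\ Lw].

End Tensors.

Definition line (R : realType) : charted R := {|
  carrier := R;
  mdim := 1;
  chart_dom := fun=> setT;
  chart := fun _ t => t%:M;
  chart_inv := fun _ x => x 0 0
|}.

Definition prod_charted (R : realType) (M N : charted R) : charted R := {|
  carrier := (M * N)%type;
  mdim := (mdim M + mdim N)%N;
  chart_dom := fun p => chart_dom p.1 `*` chart_dom p.2;
  chart := fun p q => row_mx (chart p.1 q.1) (chart p.2 q.2);
  chart_inv := fun p x =>
    (chart_inv p.1 (lsubmx x), chart_inv p.2 (rsubmx x))
|}.

(* The preferred charts of R x N are products, hence the tangent space at (t,p)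
   is the sum of the tangent spaces at t and at p. *)
Section SasakianLift.
Context {R : realType} (N : charted R) (J : endo N) (g : form2 N)
        (tau : form1 N).

Definition lift_mfd : charted R := prod_charted (line R) N.

(* The differential of the projection to N in the preferred charts. *)
Definition dpi2 : 'M[R]_(1 + mdim N, mdim N) := col_mx 0 1%:M.

Definition pull1 (theta : form1 N) : form1 lift_mfd :=
  fun q => dpi2 *m theta q.2.
Definition pull2 (h : form2 N) : form2 lift_mfd :=
  fun q => dpi2 *m h q.2 *m dpi2^T.

Definition xi : vfield lift_mfd :=
  fun=> row_mx 1%:M (0 : 'rV[R]_(mdim N)).
Definition dt : form1 lift_mfd :=
  fun=> col_mx 1%:M (0 : 'cV[R]_(mdim N)).
Definition eta : form1 lift_mfd := fun q => dt q + pull1 tau q.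

Definition vlift (X : vfield N) : vfield lift_mfd :=
  fun q => row_mx (0 : 'rV[R]_1) (X q.2) - ap1 tau X q.2 *: xi q.

(* phi(w) is the lift of J(dpi2 w) *)
Definition phi : endo lift_mfd :=
  fun q => dpi2 *m J q.2 *m row_mx (- tau q.2) 1%:M.

Definition gL : form2 lift_mfd :=
  fun q => eta q *m (eta q)^T + pull2 g q.

Definition fundamental_form : form2 lift_mfd := comp2E gL phi.

Lemma phi_vlift (X : vfield N) : apE phi (vlift X) = vlift (apE J X).
Proof.
apply/funext => q.
have -> : vlift (apE J X) q = X q.2 *m J q.2 *m row_mx (- tau q.2) 1%:M.
  rewrite /vlift /ap1 /apE /xi scale_row_mx opp_row_mx add_row_mx scaler0 oppr0.
  rewrite addr0 add0r mul_mx_row mulmx1 mulmxN; congr row_mx.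
  by rewrite -mul_scalar_mx mulmx1 -mx11_scalar.
rewrite /apE /phi !mulmxA; congr (_ *m _ *m _).
rewrite /vlift /xi /dpi2 scale_row_mx opp_row_mx add_row_mx mul_row_col.
by rewrite mulmx0 mulmx1 add0r scaler0 subr0.
Qed.

Lemma phi_xi : apE phi xi = (fun=> 0).
Proof.
by apply/funext => q; rewrite /apE /phi /xi /dpi2 !mulmxA mul_row_col mulmx0
  mul0mx addr0 !mul0mx.
Qed.

Lemma phi_unique (psi : endo lift_mfd) :
  (forall X, apE psi (vlift X) = vlift (apE J X)) ->
  apE psi xi = (fun=> 0) -> psi = phi.
Proof.
move=> hl hx; apply/funext => q.
suff H (w : 'rV[R]_(1 + mdim N)) : w *m psi q = w *m phi q.
  by apply/row_matrixP => i; rewrite !rowE; exact: H.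
pose X : vfield N := fun=> rsubmx w.
pose c := lsubmx w 0 0 + ap1 tau X q.2.
pose v : 'rV[R]_(1 + mdim N) := vlift X q.
pose x : 'rV[R]_(1 + mdim N) := xi q.
have -> : w = v + c *: x.
  rewrite /v /x /vlift -addrA -scaleNr -scalerDl /c addrCA addNr addr0.
  rewrite /xi scale_row_mx scaler0 add_row_mx add0r addr0 -mul_scalar_mx mulmx1.
  by rewrite -mx11_scalar hsubmxK.
have hv : v *m psi q = v *m phi q.
  have e : apE psi (vlift X) = apE phi (vlift X) by rewrite hl phi_vlift.
  by have := congr1 (fun f : vfield lift_mfd => f q) e.
have hxi : x *m psi q = x *m phi q.
  have e : apE psi xi = apE phi xi by rewrite hx phi_xi.
  by have := congr1 (fun f : vfield lift_mfd => f q) e.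
have D (A : 'M[R]_(1 + mdim N)) : (v + c *: x) *m A = v *m A + c *: (x *m A).
  by rewrite mulmxDl -scalemxAl.
have e : v *m psi q + c *: (x *m psi q) = v *m phi q + c *: (x *m phi q).
  by rewrite hv hxi.
exact: etrans (D (psi q)) (etrans e (esym (D (phi q)))).
Qed.

End SasakianLift.

Arguments xi {R} N _.

(* Main.v *)
(* In local coordinates the Lie and exterior derivatives of tensors are
   first-order expressions in the components, the derivatives of the test fields
   cancelling, so each claim is an identity of matrices at one
   point.  With Q = dpi2^T - tau xi the horizontal lift, one has V^L = V Q,
   phi = dpi2 J Q and Q eta = 0, whence i_{V^L} g^L = pi^* (i_V g),
   alpha^phi = pi^* (i_V omega) and Phi = pi^* omega.  The failure of V^L to
   preserve phi and g^L comes only from the derivatives of tau, which combine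
   into 2 dtau = 2 omega; Phi is preserved because L_V omega = 0, and
   d (i_V omega) = L_V omega - i_V d omega = 0. *)
(* Loaded before Defs: HB.structures also exports a constant named eta. *)
From HB Require Import structures.
Require Import Defs.
From mathcomp Require Import all_boot all_order all_algebra.
From mathcomp Require Import all_classical all_reals all_analysis.
From mathcomp Require Import ring lra.
Import Order.TTheory GRing.Theory Num.Theory.
Import numFieldNormedType.Exports.
Local Open Scope classical_set_scope.
Local Open Scope ring_scope.
Set Implicit Arguments.
Unset Strict Implicit.
Unset Printing Implicit Defensive.

(** * Differentials of matrix-valued maps *)

Section MatrixCalculus.
Context {R : realType}.

Lemma mx_continuous (T : topologicalType) (m n : nat) (f : T -> 'M[R]_(m, n)) x :
  (forall i j, {for x, continuous (fun y => f y i j)}) -> {for x, continuous f}.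
Proof.
move=> fc; apply/cvg_ballP => e e0.
have : \forall y \near x, forall i j, ball (f x i j) e (f y i j).
  apply: filter_forall => i; apply: filter_forall => j.
  exact: (cvg_ball (fc i j) e0).
by apply: filterS => y hy; split.
Qed.

Lemma linear_mx_continuous (m n p q : nat) (f : {linear 'M[R]_(m, n) -> 'M[R]_(p, q)}) :
  continuous f.
Proof.
move=> x; apply: mx_continuous => i j.
(* Expansion along the matrix units reduces the claim to continuity of coordinates. *)
have -> : (fun y => f y i j) =
    (fun y => \sum_k \sum_l y k l * f (delta_mx k l) i j).
  apply/funext => y; rewrite [in LHS](matrix_sum_delta y) linear_sum summxE.
  apply: eq_bigr => k _; rewrite linear_sum summxE; apply: eq_bigr => l _.
  by rewrite linearZ mxE.
apply: (continuous_big add_continuous) => k _.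
apply: (continuous_big add_continuous) => l _ y.
exact: (cvgM (@coord_continuous R m n k l y) (cvg_cst (f (delta_mx k l) i j))).
Qed.

Lemma is_diff_linear_mx (m n p q : nat) (f : {linear 'M[R]_(m, n) -> 'M[R]_(p, q)}) x :
  is_diff x f f.
Proof.
have fc := @linear_mx_continuous _ _ _ _ f.
by apply: DiffDef; [exact: linear_differentiable|exact: diff_lin].
Qed.

Lemma mulmx_continuous (m n p : nat) :
  continuous (fun z : 'M[R]_(m, n) * 'M[R]_(n, p) => z.1 *m z.2).
Proof.
move=> z; apply: mx_continuous => i j.
have -> : (fun y : 'M[R]_(m, n) * 'M[R]_(n, p) => (y.1 *m y.2) i j) =
    (fun y => \sum_k y.1 i k * y.2 k j).
  by apply/funext => y; rewrite mxE.
apply: (continuous_big add_continuous) => k _ y; apply: cvgM.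
- apply: (@cvg_comp _ _ _ fst (fun M : 'M[R]_(m, n) => M i k)); first exact: cvg_fst.
  exact: coord_continuous.
- apply: (@cvg_comp _ _ _ snd (fun M : 'M[R]_(n, p) => M k j)); first exact: cvg_snd.
  exact: coord_continuous.
Qed.

Section Diff.
Context {E : normedModType R}.
Implicit Types x : E.

Lemma is_diff_mulmx (m n p : nat) (f df : E -> 'M[R]_(m, n)) (g dg : E -> 'M[R]_(n, p)) x :
  is_diff x f df -> is_diff x g dg ->
  is_diff x (fun y => f y *m g y) (fun v => f x *m dg v + df v *m g x).
Proof.
move=> hf hg.
have hm : is_diff (f x, g x) (fun z : 'M[R]_(m, n) * 'M[R]_(n, p) => z.1 *m z.2)
    (fun v => f x *m v.2 + v.1 *m g x).
  apply: DiffDef.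
    exact: (@differentiable_bilin _ _ _ _ (@mulmx R m n p) _ (@mulmx_continuous _ _ _)).
  exact: (@diff_bilin _ _ _ _ (@mulmx R m n p) _ (@mulmx_continuous _ _ _)).
exact: (@is_diff_comp _ _ _ _ (fun y => (f y, g y)) (fun v => (df v, dg v)) _ _ x _ hm).
Qed.

(** The coordinate identities below are proved only near the center of a chart; this carries a
    differential across them. Both maps have the same value at [x] and the same first-order
    remainder near it. *)
Lemma is_diff_near (W : normedModType R) (f g df : E -> W) x :
  (\forall y \near x, f y = g y) -> is_diff x f df -> is_diff x g df.
Proof.
move=> fg hf; have fgx : f x = g x by apply: nbhs_singleton fg.
have /diff_locallyP[dc] : differentiable f x by [].
have d0 : 'd f x = df :> (E -> W) by exact: diff_val.
move=> /eqaddoP fo.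
have go : g \o shift x = cst (g x) + 'd f x +o_ (0 : E) id.
  apply/eqaddoP => e e0; have := fo e e0.
  have h : \forall y \near (0 : E), f (y + x) = g (y + x).
    by move: fg; rewrite (near_shift 0) subr0.
  apply: filterS2 h => y /= fgy.
  by rewrite !fctE /= -fgx -fgy.
have dg : 'd g x = 'd f x :> (E -> W) by exact: diff_unique.
apply: DiffDef; last by rewrite dg.
by apply/diff_locallyP; rewrite dg.
Qed.

Lemma is_diffE (W : normedModType R) (f df : E -> W) x v :
  is_diff x f df -> 'd f x v = df v.
Proof. by move=> h; have -> : 'd f x = df :> (E -> W) by exact: diff_val. Qed.

Lemma is_diff_linear_comp (m n p q : nat) (L : {linear 'M[R]_(m, n) -> 'M[R]_(p, q)})
    (f df : E -> 'M[R]_(m, n)) x :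
  is_diff x f df -> is_diff x (fun y => L (f y)) (fun v => L (df v)).
Proof.
by move=> hf; apply: (is_diff_comp (g := L) hf); exact: is_diff_linear_mx.
Qed.

Lemma smooth_near_differentiable (W : normedModType R) x (f : E -> W) :
  smooth_near x f -> differentiable f x.
Proof. by move=> [U [[_ Ux] /(_ 1%N) [+ _]]]; exact. Qed.

(** Needed so that fields with constant components in a chart are admissible test fields. *)
Lemma smooth_near_cst (W : normedModType R) x (f : E -> W) (c : W) :
  (\forall y \near x, f y = c) -> smooth_near x f.
Proof.
rewrite /prop_near1 nbhsE => -[U Ux UP]; exists U; split=> // k.
have d0 h (a : W) y : (forall z, U z -> h z = a) -> U y -> is_diff y h 0.
  move=> ha Uy; apply: (@is_diff_near _ (cst a)).
  by apply: filterS (open_nbhs_nbhs (conj Ux.1 Uy)) => z /ha ->.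
(* [f] and [c] stay general because the induction hypothesis is applied to the derivative, which is
   constantly 0 on [U]. *)
elim: k f c UP => [|k IH] f c UP.
  by move=> y Uy; apply: differentiable_continuous; have [] := d0 _ _ _ UP Uy.
split; first by move=> y /(d0 _ _ _ UP) [].
by move=> v; apply: (IH _ 0) => y Uy; have := d0 _ _ _ UP Uy => hd; rewrite diff_val.
Qed.

Lemma is_diff_coord (m n : nat) (f df : E -> 'M[R]_(m, n)) x i j :
  is_diff x f df -> is_diff x (fun y => f y i j : R) (fun v => df v i j : R).
Proof.
move=> hf.
have lin : linear (fun N : 'M[R]_(m, n) => N i j : R) by move=> a u w; rewrite !mxE.
pose linM := GRing.isLinear.Build _ _ _ _ _ lin.
pose c : {linear 'M[R]_(m, n) -> R} := HB.pack (fun N : 'M[R]_(m, n) => N i j : R) linM.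
have cc : continuous c by exact: coord_continuous.
have hc : is_diff (f x) c c.
  by apply: DiffDef; [exact: linear_differentiable|exact: diff_lin].
exact: is_diff_comp hf hc.
Qed.
Lemma is_diff_unique (W : normedModType R) (f df dg : E -> W) x :
  is_diff x f df -> is_diff x f dg -> df =1 dg.
Proof. by move=> h k v; rewrite -(is_diffE v h) (is_diffE v k). Qed.

End Diff.
End MatrixCalculus.

(** * Tensor fields in coordinates *)

(* What the coordinate formulas use of the manifold axioms, in a form that is
   easily transferred from [N] to [lift_mfd N]. *)
Record compatible_charts (R : realType) (M : charted R) : Prop := CompatibleCharts {
  chart_invK : forall p : M, chart_inv p (chart p p) = p;
  transJ_id : forall p : M, transJ p p p = 1%:M;
  transJ_near : forall p : M, \forall x \near chart p p,
    let q := chart_inv p x in transJ p q q *m transJ q p q = 1%:M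
}.

Section Coordinates.
Context {R : realType} (M : charted R) (hM : compatible_charts M).
Implicit Types (p : M) (X Y Z V : vfield M) (theta : form1 M) (T : endo M) (h : form2 M).

Lemma rep_vf_center p X : rep_vf p X (chart p p) = X p.
Proof. by rewrite /rep_vf (chart_invK hM) (transJ_id hM) mulmx1. Qed.

Lemma rep_f1_center p theta : rep_f1 p theta (chart p p) = theta p.
Proof. by rewrite /rep_f1 (chart_invK hM) (transJ_id hM) mul1mx. Qed.

Lemma rep_endo_center p T : rep_endo p T (chart p p) = T p.
Proof. by rewrite /rep_endo (chart_invK hM) (transJ_id hM) mulmx1 mul1mx. Qed.

Lemma rep_f2_center p h : rep_f2 p h (chart p p) = h p.
Proof. by rewrite /rep_f2 (chart_invK hM) (transJ_id hM) trmx1 mulmx1 mul1mx. Qed.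

(** Each contraction pairs a Jacobian with its inverse, so it commutes with passing to coordinates
    near the center. The next four lemmas rest on the same cancellation. *)
Lemma rep_apE p T X : \forall x \near chart p p,
  rep_vf p X x *m rep_endo p T x = rep_vf p (apE T X) x.
Proof.
apply: filterS (transJ_near hM p) => x /= /mulmx1C h.
rewrite /rep_vf /rep_endo /apE; move: (transJ _ _ _) (transJ _ _ _) h => s t h.
by rewrite !mulmxA -(mulmxA (X _)) h mulmx1.
Qed.

Lemma rep_ap1 p theta X : \forall x \near chart p p,
  (rep_vf p X x *m rep_f1 p theta x) 0 0 = ap1 theta X (chart_inv p x).
Proof.
apply: filterS (transJ_near hM p) => x /= /mulmx1C h.
by rewrite /rep_vf /rep_f1 /ap1 !mulmxA -(mulmxA (X _)) h mulmx1.
Qed.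

Lemma rep_ap2 p h X Y : \forall x \near chart p p,
  (rep_vf p X x *m rep_f2 p h x *m (rep_vf p Y x)^T) 0 0 = ap2 h X Y (chart_inv p x).
Proof.
apply: filterS (transJ_near hM p) => x /= /mulmx1C e.
rewrite /rep_vf /rep_f2 /ap2; move: (transJ _ _ _) (transJ _ _ _) e => s t e.
rewrite !mulmxA -(mulmxA (X _)) e mulmx1 trmx_mul mulmxA.
by rewrite -(mulmxA (_ *m h _)) -trmx_mul e trmx1 mulmx1.
Qed.

Lemma rep_comp2E p h T : \forall x \near chart p p,
  rep_f2 p h x *m (rep_endo p T x)^T = rep_f2 p (comp2E h T) x.
Proof.
apply: filterS (transJ_near hM p) => x /= /mulmx1C e.
rewrite /rep_f2 /rep_endo /comp2E; move: (transJ _ _ _) (transJ _ _ _) e => t s e.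
rewrite !trmx_mul !mulmxA; congr (_ *m _ *m _).
by rewrite -(mulmxA (_ *m h _)) -trmx_mul e trmx1 mulmx1.
Qed.

Lemma rep_vcontract p h X : \forall x \near chart p p,
  (rep_vf p X x *m rep_f2 p h x)^T = rep_f1 p (vcontract h X) x.
Proof.
apply: filterS (transJ_near hM p) => x /= /mulmx1C e.
rewrite /rep_vf /rep_f2 /rep_f1 /vcontract; move: (transJ _ _ _) (transJ _ _ _) e => s t e.
rewrite !mulmxA -(mulmxA (X _)) e mulmx1.
by rewrite trmx_mul trmxK.
Qed.

Section At.
Variable p : M.
Local Notation x0 := (chart p p).
Local Notation n := (mdim M).
Implicit Types (DX DY DV : 'rV[R]_n -> 'rV[R]_n) (Dtheta : 'rV[R]_n -> 'cV[R]_n)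
  (DT Dh : 'rV[R]_n -> 'M[R]_n).

Lemma bracket_coord X Y DX DY : is_diff x0 (rep_vf p X) DX -> is_diff x0 (rep_vf p Y) DY ->
  bracket X Y p = DY (X p) - DX (Y p).
Proof.
by move=> dX dY; exact: (congr2 (fun a b => a - b) (is_diffE _ dY) (is_diffE _ dX)).
Qed.

Lemma is_diff_apE T X DX DT : is_diff x0 (rep_vf p X) DX -> is_diff x0 (rep_endo p T) DT ->
  is_diff x0 (rep_vf p (apE T X)) (fun v => X p *m DT v + DX v *m T p).
Proof.
move=> dX dT; have := is_diff_near (rep_apE p T X) (is_diff_mulmx dX dT).
by rewrite rep_vf_center rep_endo_center.
Qed.

Lemma dirder_ap1 theta X Z DX Dtheta :
  is_diff x0 (rep_vf p X) DX -> is_diff x0 (rep_f1 p theta) Dtheta ->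
  dirder Z (ap1 theta X) p = (X p *m Dtheta (Z p) + DX (Z p) *m theta p) 0 0.
Proof.
move=> dX dT.
have := is_diff_near (rep_ap1 p theta X) (is_diff_coord 0 0 (is_diff_mulmx dX dT)).
move=> /is_diffE E; apply: etrans (E (Z p)) _.
by rewrite rep_vf_center rep_f1_center.
Qed.

Lemma dirder_ap2 h X Y Z DX DY Dh :
  is_diff x0 (rep_vf p X) DX -> is_diff x0 (rep_vf p Y) DY ->
  is_diff x0 (rep_f2 p h) Dh ->
  dirder Z (ap2 h X Y) p =
    (X p *m h p *m (DY (Z p))^T
     + (X p *m Dh (Z p) + DX (Z p) *m h p) *m (Y p)^T) 0 0.
Proof.
move=> dX dY dh; have dYt := is_diff_linear_comp trmx dY.
have := is_diff_near (rep_ap2 p h X Y)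
  (is_diff_coord 0 0 (is_diff_mulmx (is_diff_mulmx dX dh) dYt)).
move=> /is_diffE E; apply: etrans (E (Z p)) _.
by rewrite !rep_vf_center rep_f2_center.
Qed.

(** Tensoriality: [DY (V p)] occurs in both brackets with the same factor [T p] and cancels. The
    derivatives of the test fields drop out in the same way in [lie2_coord] and [extd1_coord]. *)
Lemma lieE_coord V T Y DV DY DT :
  is_diff x0 (rep_vf p V) DV -> is_diff x0 (rep_vf p Y) DY ->
  is_diff x0 (rep_endo p T) DT ->
  lieE V T Y p = Y p *m DT (V p) - DV (Y p *m T p) + DV (Y p) *m T p.
Proof.
move=> dV dY dT; rewrite /lieE (bracket_coord dV (is_diff_apE dY dT)) /apE.
rewrite (bracket_coord dV dY) mulmxBl opprB addrA addrAC; congr (_ + _).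
by rewrite addrAC addrK.
Qed.

Lemma lie2_coord V h X Y DV DX DY Dh :
  is_diff x0 (rep_vf p V) DV -> is_diff x0 (rep_vf p X) DX ->
  is_diff x0 (rep_vf p Y) DY -> is_diff x0 (rep_f2 p h) Dh ->
  lie2 V h X Y p =
    (X p *m Dh (V p) *m (Y p)^T + DV (X p) *m h p *m (Y p)^T
     + X p *m h p *m (DV (Y p))^T) 0 0.
Proof.
move=> dV dX dY dh; rewrite /lie2 (dirder_ap2 _ dX dY dh) /ap2.
rewrite (bracket_coord dV dX) (bracket_coord dV dY).
rewrite linearB /= mulmxBr !mulmxBl mulmxDl.
have addE (A B : 'M[R]_1) : (A + B) 0 0 = A 0 0 + B 0 0 by rewrite mxE.
have oppE (A : 'M[R]_1) : (- A) 0 0 = - A 0 0 by rewrite mxE.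
rewrite !addE !oppE.
by ring.
Qed.

Lemma extd1_coord theta X Y DX DY Dtheta :
  is_diff x0 (rep_vf p X) DX -> is_diff x0 (rep_vf p Y) DY ->
  is_diff x0 (rep_f1 p theta) Dtheta ->
  extd1 theta X Y p = 2^-1 * (Y p *m Dtheta (X p) - X p *m Dtheta (Y p)) 0 0.
Proof.
move=> dX dY dt; rewrite /extd1 (dirder_ap1 _ dX dt) (dirder_ap1 _ dY dt) /ap1.
rewrite (bracket_coord dX dY) mulmxBl.
have addE (A B : 'M[R]_1) : (A + B) 0 0 = A 0 0 + B 0 0 by rewrite mxE.
have oppE (A : 'M[R]_1) : (- A) 0 0 = - A 0 0 by rewrite mxE.
rewrite !addE !oppE.
by congr (_ * _); ring.
Qed.

(* The field with constant components [v] in the chart at [p]. *)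
Definition const_vf (v : 'rV[R]_(mdim M)) : vfield M := fun q => v *m transJ p q q.

Lemma const_vfE v : const_vf v p = v.
Proof. by rewrite /const_vf (transJ_id hM) mulmx1. Qed.

Lemma rep_const_vf v : \forall x \near x0, rep_vf p (const_vf v) x = v.
Proof.
apply: filterS (transJ_near hM p) => x /= h.
by rewrite /rep_vf /const_vf -mulmxA h mulmx1.
Qed.

Lemma const_vf_smooth v : vf_smooth_near p (const_vf v).
Proof. exact: smooth_near_cst (rep_const_vf v). Qed.

Lemma is_diff_const_vf v : is_diff x0 (rep_vf p (const_vf v)) (fun=> 0).
Proof.
apply: (@is_diff_near _ _ _ (cst v)).
by apply: filterS (rep_const_vf v) => x ->.
Qed.

End At.
End Coordinates.

(** * Jacobians of transition maps *)

Section Transition.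
Context {R : realType} (N : charted R) (hN : is_manifold N).

Lemma transition_differentiable (p q r : N) : chart_dom p r -> chart_dom q r ->
  differentiable (chart q \o chart_inv p) (chart p r).
Proof.
move=> pr qr; case: hN => _ _ _ _ _ _ _ _ /(_ p q 1%N) [+ _]; apply.
by exists r.
Qed.

(** Chain rule for the two opposite transition maps, whose composite is the identity near
    [chart p q]. *)
Lemma transJ_inv (p q : N) : chart_dom p q -> transJ p q q *m transJ q p q = 1%:M.
Proof.
move=> pq; case: (hN) => _ _ dom opn opni inv _ ci _.
have df := differentiableP (transition_differentiable pq (dom q)).
have dg := differentiableP (transition_differentiable (dom q) pq).
have fx : (chart q \o chart_inv p) (chart p q) = chart q q by rewrite /= inv.
rewrite -fx in dg; have dgf := is_diff_comp df dg.
have did : is_diff (chart p q) ((chart p \o chart_inv q) \o (chart q \o chart_inv p)) id.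
  apply: (@is_diff_near _ _ _ id).
  (* The composite can be simplified where [chart_inv p y] lies in the domain of the chart at [q]
     and [y] in the image of the chart at [p]; both conditions hold near [chart p q]. *)
  have nq : \forall y \near chart p q, chart_dom q (chart_inv p y).
    apply: (ci _ _ pq); rewrite inv //; apply: open_nbhs_nbhs.
    by split; [exact: opn|exact: dom].
  have np : \forall y \near chart p q, (chart p @` chart_dom p) y.
    by apply: open_nbhs_nbhs; split; [exact: opni|exists q].
  by apply: filterS2 nq np => y /= yq [r pr ry]; rewrite inv // -ry inv.
apply/row_matrixP => i; rewrite !rowE mulmx1.
have /(_ (delta_mx 0 i)) /= E := is_diff_unique dgf did.
rewrite -[RHS]E mulmxA /transJ /jacobian !mul_rV_lin1 /=.
by rewrite inv.
Qed.

Lemma near_chart_dom (p : N) : \forall x \near chart p p, chart_dom p (chart_inv p x).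
Proof.
case: hN => _ _ dom opn _ inv _ ci _.
apply: (ci _ _ (dom p)); rewrite inv //; apply: open_nbhs_nbhs.
by split; [exact: opn|exact: dom].
Qed.

Lemma manifold_compatible : compatible_charts N.
Proof.
have [_ _ dom _ opni inv _ _ _] := hN; split=> p.
- exact: inv.
- have id_near : \forall x \near chart p p, id x = (chart p \o chart_inv p) x.
    have np : \forall y \near chart p p, (chart p @` chart_dom p) y.
      by apply: open_nbhs_nbhs; split; [exact: opni|exists p].
    by apply: filterS np => y [r pr <-] /=; rewrite inv.
  have did := is_diff_near id_near (is_diff_id (chart p p)).
  apply/row_matrixP => i; rewrite !rowE mulmx1 /transJ /jacobian mul_rV_lin1.
  exact: is_diffE did.
- by apply: filterS (near_chart_dom p) => x /transJ_inv.
Qed.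

End Transition.

(** * The lift in coordinates *)

(* [e] is the row of [xi] and [P] the matrix of the projection, with e P = 0 and
   P^T P = 1; thus [e^T *m e + P *m s *m P^T] is the block matrix diag(1, s), and
   [P^T - tau *m e] the matrix of the horizontal lift. *)
Section LiftCharts.
Context {R : realType} (N : charted R) (hN : is_manifold N).
Local Notation M := (lift_mfd N).
Local Notation m := (mdim N).
Local Notation e := (row_mx 1%:M 0 : 'rV[R]_(1 + m)).
Local Notation P := (dpi2 N).

Lemma trmx_dpi2 : P^T = row_mx 0 1%:M.
Proof. by rewrite /dpi2 tr_col_mx trmx0 trmx1. Qed.

Lemma xi_dpi2 : e *m P = 0.
Proof. by rewrite /dpi2 mul_row_col mulmx0 mul0mx addr0. Qed.

Lemma dpi2T_dpi2 : P^T *m P = 1%:M.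
Proof. by rewrite trmx_dpi2 /dpi2 mul_row_col mulmx0 mulmx1 add0r. Qed.

Lemma xi_dt : e *m e^T = 1%:M.
Proof. by rewrite tr_row_mx trmx0 trmx1 mul_row_col mulmx0 mulmx1 addr0. Qed.

Lemma dpi2T_dt : P^T *m e^T = 0.
Proof. by rewrite -trmx_mul xi_dpi2 trmx0. Qed.

Lemma mul_dpi2 (x : 'rV[R]_(1 + m)) : x *m P = rsubmx x.
Proof. by rewrite -[in LHS](hsubmxK x) /dpi2 mul_row_col mulmx0 mulmx1 add0r. Qed.

Lemma mul_dt (x : 'rV[R]_(1 + m)) : x *m e^T = lsubmx x.
Proof.
rewrite -[in LHS](hsubmxK x) tr_row_mx trmx0 trmx1 mul_row_col mulmx0 mulmx1.
by rewrite addr0.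
Qed.

Lemma tangent_lift_split (x : 'rV[R]_(1 + m)) : x = x *m e^T *m e + x *m P *m P^T.
Proof.
rewrite mul_dpi2 mul_dt trmx_dpi2 !mul_mx_row !mulmx0 !mulmx1 add_row_mx.
by rewrite addr0 add0r hsubmxK.
Qed.

Lemma tangent_lift_partition : e^T *m e + P *m P^T = 1%:M.
Proof.
apply/row_matrixP => i; rewrite !rowE mulmx1 mulmxDr !mulmxA.
by rewrite -tangent_lift_split.
Qed.

Lemma mul_lift_frames (s t : 'M[R]_m) :
  (e^T *m e + P *m s *m P^T) *m (e^T *m e + P *m t *m P^T)
  = e^T *m e + P *m (s *m t) *m P^T.
Proof.
rewrite mulmxDr !mulmxDl !mulmxA.
rewrite -(mulmxA e^T e e^T) xi_dt mulmx1 -(mulmxA e^T e P) xi_dpi2 mulmx0 !mul0mx.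
rewrite -(mulmxA _ P^T e^T) dpi2T_dt mulmx0 mul0mx addr0 add0r.
by rewrite -(mulmxA _ P^T P) dpi2T_dpi2 mulmx1.
Qed.

Lemma near_lift (p : M) (A : 'rV[R]_m -> Prop) :
  (\forall y \near chart p.2 p.2, A y) -> \forall x \near chart p p, A (x *m P).
Proof.
move=> hA.
have c : {for chart p p, continuous (fun x : 'rV[R]_(1 + m) => x *m P)}.
  exact: (@linear_mx_continuous R _ _ _ _ (mulmxr P)).
by apply: c; rewrite mul_dpi2 row_mxKr.
Qed.

(** In product charts a transition map is the identity on the line and the transition map of [N] on
    the other factor. It is written as a linear map plus [f] after the projection, which makes its
    Jacobian block diagonal. *)
Lemma transJ_lift (p q r : M) : chart_dom p.2 r.2 -> chart_dom q.2 r.2 ->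
  transJ p q r = e^T *m e + P *m transJ p.2 q.2 r.2 *m P^T.
Proof.
move=> pr qr; have df := differentiableP (transition_differentiable hN pr qr).
set f := chart q.2 \o chart_inv p.2 in df.
have dl : is_diff (chart p r) (fun x : 'rV[R]_(1 + m) => x *m P) (fun x => x *m P).
  exact: (is_diff_linear_mx (mulmxr P) _).
have Er : chart p r *m P = chart p.2 r.2 by rewrite mul_dpi2 row_mxKr.
rewrite -Er in df.
have d1 := is_diff_linear_comp (mulmxr P^T) (is_diff_comp dl df).
have d2 := is_diff_linear_mx (mulmxr (e^T *m e)) (chart p r).
have d := is_diffD d2 d1.
have E : (chart q \o chart_inv p) = (mulmxr (e^T *m e) : 'rV[R]_(1 + m) -> _) +
    (fun y => mulmxr P^T ((f \o (fun x => x *m P)) y)).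
  apply/funext => x /=; rewrite [LHS](tangent_lift_split) !fctE /=.
  rewrite mul_dpi2 row_mxKr mul_dpi2; apply: congr2; last by [].
  by rewrite mulmxA !mul_dt row_mxKl -mx11_scalar.
apply/row_matrixP => i; rewrite !rowE /transJ /jacobian E !mul_rV_lin1.
rewrite (is_diffE _ d) !fctE /= mulmxDr; congr (_ + _).
by rewrite !mulmxA -(mulmxA (delta_mx 0 i)) mulmxA mul_rV_lin1 Er.
Qed.

Lemma lift_compatible : compatible_charts M.
Proof.
have hc := manifold_compatible hN; have [_ _ dom _ _ inv _ _ _] := hN; split=> p.
- by case: p => t p /=; rewrite row_mxKl row_mxKr inv // mxE eqxx.
- by rewrite transJ_lift // (transJ_id hc) mulmx1; exact: tangent_lift_partition.
- have := near_lift (near_chart_dom hN p.2).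
  apply: filterS => x; rewrite mul_dpi2 => hx /=.
  rewrite !transJ_lift //; apply: etrans (mul_lift_frames _ _) _.
  by rewrite transJ_inv // mulmx1; exact: tangent_lift_partition.
Qed.

End LiftCharts.

(** * Components of the lifted tensors in product charts *)

Section LiftRepresentatives.
Context {R : realType} (N : charted R) (hN : is_manifold N) (tau : form1 N).
Local Notation M := (lift_mfd N).
Local Notation m := (mdim N).
Local Notation e := (row_mx 1%:M 0 : 'rV[R]_(1 + m)).
Local Notation P := (dpi2 N).
Implicit Types (X : vfield N) (theta : form1 N) (T J : endo N) (h g : form2 N) (p : M).

Lemma vliftE X (q : M) : vlift tau X q = X q.2 *m (P^T - tau q.2 *m e).
Proof.
rewrite /vlift /ap1 /xi mulmxBr mulmxA [X q.2 *m tau _ as Z in _ - Z *m _]mx11_scalar.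
rewrite mul_scalar_mx; congr (_ - _).
by rewrite trmx_dpi2 mul_mx_row mulmx0 mulmx1.
Qed.

Lemma phiE J (q : M) : phi J tau q = P *m J q.2 *m (P^T - tau q.2 *m e).
Proof.
rewrite /phi; congr (_ *m _); rewrite trmx_dpi2 mul_mx_row mulmx1 mulmx0.
by rewrite opp_row_mx add_row_mx add0r oppr0 addr0.
Qed.

Lemma etaE (q : M) : eta tau q = e^T + P *m tau q.2.
Proof. by rewrite /eta /dt /pull1 tr_row_mx trmx1 trmx0. Qed.

Section Frames.
Variable s : 'M[R]_m.
Let F : 'M[R]_(1 + m) := e^T *m e + P *m s *m P^T.

(** [F] is the Jacobian of a change of product charts. The four rules of this section move it past
    [P] and [P^T] and absorb it into [e] and [e^T], so that no block computation is needed later. *)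
Lemma frame_dpi2 : F *m P = P *m s.
Proof.
by rewrite /F mulmxDl -!(mulmxA _ _ P) xi_dpi2 dpi2T_dpi2 mulmx0 add0r mulmx1.
Qed.

Lemma frame_dt : F *m e^T = e^T.
Proof.
by rewrite /F mulmxDl -!(mulmxA _ _ e^T) xi_dt dpi2T_dt mulmx0 addr0 mulmx1.
Qed.

Lemma dpi2T_frame : P^T *m F = s *m P^T.
Proof. by rewrite /F mulmxDr !mulmxA dpi2T_dt mul0mx add0r dpi2T_dpi2 mul1mx. Qed.

Lemma xi_frame : e *m F = e.
Proof. by rewrite /F mulmxDr !mulmxA xi_dt xi_dpi2 !mul0mx addr0 mul1mx. Qed.

End Frames.

(** Names the Jacobians on [N] and on the lift simultaneously, so that the computations below deal
    with abstract matrices [s] and [t]. *)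
Lemma near_frames p : \forall x \near chart p p,
  exists s t : 'M[R]_m, let q : M := chart_inv p x in
  [/\ s *m t = 1%:M, transJ p.2 q.2 q.2 = s, transJ q.2 p.2 q.2 = t,
   transJ p q q = (e^T *m e + P *m s *m P^T : 'M[R]_(1 + m)) &
   transJ q p q = (e^T *m e + P *m t *m P^T : 'M[R]_(1 + m))].
Proof.
have [_ _ dom _ _ inv _ _ _] := hN.
have := near_lift (near_chart_dom hN p.2).
apply: filterS => x; rewrite mul_dpi2 => hx /=.
exists (transJ p.2 (chart_inv p.2 (rsubmx x)) (chart_inv p.2 (rsubmx x))).
exists (transJ (chart_inv p.2 (rsubmx x)) p.2 (chart_inv p.2 (rsubmx x))).
split=> //; first exact: transJ_inv.
- exact: transJ_lift.
- exact: transJ_lift.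
Qed.

(** The lift has the same expression in every product chart, with components on [N] in place of
    values. These depend on [x] only through [x *m P], that is, not on the coordinate of the
    line. *)
Lemma rep_vlift p X : \forall x \near chart p p,
  rep_vf p.2 X (x *m P) *m (P^T - rep_f1 p.2 tau (x *m P) *m e) = rep_vf p (vlift tau X) x.
Proof.
apply: filterS (near_frames p) => x [s [t [/mulmx1C st hs ht _ Ht]]].
rewrite /rep_vf /rep_f1 Ht vliftE mul_dpi2; rewrite /= in hs ht *; rewrite hs ht.
move: (X _) (tau _) => v u.
have E : v *m (P^T - u *m e) *m (e^T *m e + P *m t *m P^T) = v *m (t *m P^T - u *m e).
  by rewrite -mulmxA mulmxBl -[X in _ - X]mulmxA xi_frame dpi2T_frame.
apply/esym; apply: (etrans E).
by rewrite -mulmxA; congr (_ *m _); rewrite mulmxBr !mulmxA st mul1mx.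
Qed.

Lemma rep_phi p J : \forall x \near chart p p,
  P *m rep_endo p.2 J (x *m P) *m (P^T - rep_f1 p.2 tau (x *m P) *m e)
  = rep_endo p (phi J tau) x.
Proof.
apply: filterS (near_frames p) => x [s [t [/mulmx1C st hs ht Hs Ht]]].
rewrite /rep_endo /rep_f1 Hs Ht phiE mul_dpi2; rewrite /= in hs ht *; rewrite hs ht.
move: (J _) (tau _) => j u.
have E : (e^T *m e + P *m s *m P^T) *m (P *m j *m (P^T - u *m e)) *m
    (e^T *m e + P *m t *m P^T) = P *m s *m j *m (t *m P^T - u *m e).
  rewrite !mulmxA frame_dpi2 -[LHS]mulmxA; congr (_ *m _).
  by rewrite mulmxBl -[X in _ - X]mulmxA xi_frame dpi2T_frame.
apply/esym; apply: (etrans E).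
rewrite !mulmxA -(mulmxA _ t); congr (_ *m _).
by rewrite mulmxBr !mulmxA st mul1mx.
Qed.

Lemma rep_pull1 p theta : \forall x \near chart p p,
  P *m rep_f1 p.2 theta (x *m P) = rep_f1 p (pull1 theta) x.
Proof.
apply: filterS (near_frames p) => x [s [t [_ hs _ Hs _]]].
rewrite /rep_f1 Hs mul_dpi2 /pull1; rewrite /= in hs *; rewrite hs.
by rewrite !mulmxA frame_dpi2.
Qed.

Lemma rep_eta p : \forall x \near chart p p,
  e^T + P *m rep_f1 p.2 tau (x *m P) = rep_f1 p (eta tau) x.
Proof.
apply: filterS (near_frames p) => x [s [t [_ hs _ Hs _]]].
rewrite /rep_f1 Hs mul_dpi2 etaE; rewrite /= in hs *; rewrite hs.
by apply/esym; rewrite mulmxDr frame_dt !mulmxA frame_dpi2.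
Qed.

Lemma rep_pull2 p h : \forall x \near chart p p,
  P *m rep_f2 p.2 h (x *m P) *m P^T = rep_f2 p (pull2 h) x.
Proof.
apply: filterS (near_frames p) => x [s [t [_ hs _ Hs _]]].
rewrite /rep_f2 Hs mul_dpi2 /pull2; rewrite /= in hs *; rewrite hs.
move: (h _) => k; set F := e^T *m e + P *m s *m P^T.
have E : F *m (P *m k *m P^T) *m F^T = P *m (s *m k *m s^T) *m P^T.
  rewrite !mulmxA frame_dpi2 -[LHS]mulmxA -trmx_mul frame_dpi2 trmx_mul.
  by rewrite !mulmxA.
exact: (esym E).
Qed.

Lemma rep_gL p g : \forall x \near chart p p,
  rep_f1 p (eta tau) x *m (rep_f1 p (eta tau) x)^T + P *m rep_f2 p.2 g (x *m P) *m P^T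
  = rep_f2 p (gL g tau) x.
Proof.
apply: filterS (rep_pull2 p g) => x ->.
rewrite /rep_f1 /rep_f2 /gL mulmxDr mulmxDl; congr (_ + _).
by rewrite trmx_mul !mulmxA.
Qed.

End LiftRepresentatives.

Lemma mx11_ext (R : pzRingType) (A B : 'M[R]_1) : A 0 0 = B 0 0 -> A = B.
Proof. by move=> h; rewrite [A]mx11_scalar [B]mx11_scalar h. Qed.

(** * The Kahler structure at a point *)

Section LocalIdentities.
Context {R : realType} (N : charted R) (hN : compatible_charts N).
Context (J : endo N) (g : form2 N) (tau : form1 N) (V : vfield N) (p : N).
Local Notation m := (mdim N).
Local Notation x0 := (chart p p).
Context (DV : 'rV[R]_m -> 'rV[R]_m) (DJ Dg : 'rV[R]_m -> 'M[R]_m)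
  (Dtau : 'rV[R]_m -> 'cV[R]_m).
Context (dV : is_diff x0 (rep_vf p V) DV) (dJ : is_diff x0 (rep_endo p J) DJ)
  (dg : is_diff x0 (rep_f2 p g) Dg) (dtau : is_diff x0 (rep_f1 p tau) Dtau).
Context (hK : is_kahler J g).
Implicit Types u w a b c : 'rV[R]_m.

(** [W] is the matrix of the Kähler form at [p], and [DW] its derivative by the Leibniz rule. *)
Let W := g p *m (J p)^T.
Let DW w := g p *m (DJ w)^T + Dg w *m (J p)^T.

(** The right-hand sides of [lieE_coord] and [lie2_coord]: the Lie derivatives along [V] as
    functions of tangent vectors at [p]. *)
Definition lieJ_at w := w *m DJ (V p) - DV (w *m J p) + DV w *m J p.
Definition lie2_at (h : 'M[R]_m) (Dh : 'rV[R]_m -> 'M[R]_m) u w :=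
  u *m Dh (V p) *m w^T + DV u *m h *m w^T + u *m h *m (DV w)^T.

Lemma is_diff_comp2E : is_diff x0 (rep_f2 p (comp2E g J)) DW.
Proof.
have := is_diff_near (rep_comp2E hN p g J) (is_diff_mulmx dg (is_diff_linear_comp trmx dJ)).
by rewrite (rep_f2_center hN) (rep_endo_center hN).
Qed.

(** Fields with constant components realize every tangent vector at [p], so an equality on fields
    yields one on vectors. *)
Lemma lieJ_at0 : lieE_eq V J (fun=> 0) -> forall w, lieJ_at w = 0.
Proof.
move=> H w; have := H p _ (const_vf_smooth hN p w).
rewrite (lieE_coord hN dV (is_diff_const_vf hN p w) dJ) (const_vfE hN).
by rewrite /apE mulmx0.
Qed.

Lemma lie2_at0 h Dh : is_diff x0 (rep_f2 p h) Dh ->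
  lie2_eq V h (fun=> 0) -> forall u w, lie2_at (h p) Dh u w = 0.
Proof.
move=> dh H u w; have := H p _ _ (const_vf_smooth hN p u) (const_vf_smooth hN p w).
rewrite (lie2_coord hN dV (is_diff_const_vf hN p u) (is_diff_const_vf hN p w) dh).
rewrite !(const_vfE hN).
by rewrite /ap2 mulmx0 mul0mx => E; apply: mx11_ext.
Qed.

(** The Leibniz rule for omega = g(., J .). It links the three invariance conditions, so that any
    two of them give the third. *)
Lemma lie_comp2E u w :
  lie2_at W DW u w = lie2_at (g p) Dg u (w *m J p) + u *m g p *m (lieJ_at w)^T.
Proof.
have T : (lieJ_at w)^T = (DJ (V p))^T *m w^T - (DV (w *m J p))^T + (J p)^T *m (DV w)^T.
  by rewrite /lieJ_at [LHS]linearD [X in X + _]linearB /= !trmx_mul.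
rewrite T /lie2_at /W /DW trmx_mul !mulmxDr mulmxN !mulmxDl !mulmxA.
move: (u *m g p *m (DJ _)^T *m _) (u *m Dg _ *m _ *m _) (DV u *m _ *m _ *m _)
  (u *m g p *m (DV (w *m _))^T) (u *m g p *m (J p)^T *m _) => A B C D F.
by rewrite [RHS]addrA; congr (_ + _);
  rewrite -[RHS]addrA [D + _]addrC subrK -[LHS]addrA [LHS]addrC.
Qed.

Lemma inf_automorphism_at : inf_automorphism J g V ->
  [/\ forall w, lieJ_at w = 0, forall u w, lie2_at (g p) Dg u w = 0
    & forall u w, lie2_at W DW u w = 0].
Proof.
have [_ _ JJ _ gs gpos gJ _] := hK.
suff : inf_automorphism J g V ->
    (forall w, lieJ_at w = 0) /\ (forall u w, lie2_at (g p) Dg u w = 0).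
  move=> H /H[hJ hg]; split=> // u w.
  by rewrite lie_comp2E hJ hg linear0 mulmx0 addr0.
case=> [[hJ hg]|[hJ hw]|[hg hw]].
- by split; [exact: lieJ_at0|exact: lie2_at0].
- split; first exact: lieJ_at0.
  (* Since J^2 = -1, the vector [- w *m J p] is the preimage of [w] under J; this recovers L_V g
     from L_V omega. *)
  move=> u w; have := lie_comp2E u (- w *m J p).
  rewrite (lie2_at0 is_diff_comp2E hw) (lieJ_at0 hJ) linear0 mulmx0 addr0.
  by rewrite -mulmxA JJ mulmxN mulNmx mulmx1 opprK => <-.
- have hg' := lie2_at0 dg hg; split=> // w.
  (* With (L_V J)(w) itself in the first slot, the rule says that this vector has g-norm zero, and g
     is positive definite. *)
  have := lie_comp2E (lieJ_at w) w.
  rewrite (lie2_at0 is_diff_comp2E hw) hg' add0r => /esym E.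
  apply/eqP; apply: contraT => /(gpos p).
  by rewrite E mxE ltxx.
Qed.

(** The left side is 2 dtau(a, b) on fields with constant components; the factor 2 comes from the
    normalization in [extd1]. *)
Lemma dtau_at : extd1_eq tau (comp2E g J) ->
  forall a b, b *m Dtau a - a *m Dtau b = 2 *: (a *m W *m b^T).
Proof.
move=> H a b; have := H p _ _ (const_vf_smooth hN p a) (const_vf_smooth hN p b).
rewrite (extd1_coord hN (is_diff_const_vf hN p a) (is_diff_const_vf hN p b) dtau).
rewrite !(const_vfE hN) /ap2 !(const_vfE hN) => E; apply: mx11_ext; rewrite [RHS]mxE.
apply: (etrans _ (congr1 (fun z => 2 * z) E)).
by rewrite mulrA divff ?mul1r // pnatr_eq0.
Qed.

(** Evaluates d omega = 0 on fields with constant components, whose brackets vanish at [p]. *)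
Lemma closed_at : forall a b c,
  b *m DW a *m c^T + c *m DW b *m a^T + a *m DW c *m b^T = 0.
Proof.
have [_ _ _ _ _ _ _ cl] := hK.
move=> a b c.
have := cl p _ _ _ (const_vf_smooth hN p a) (const_vf_smooth hN p b)
  (const_vf_smooth hN p c).
have da := is_diff_const_vf hN p a; have db := is_diff_const_vf hN p b.
have dc := is_diff_const_vf hN p c; have dW := is_diff_comp2E.
rewrite /extd2 (dirder_ap2 hN _ db dc dW) (dirder_ap2 hN _ dc da dW).
rewrite (dirder_ap2 hN _ da db dW).
rewrite /ap2 (bracket_coord da db) (bracket_coord db dc) (bracket_coord dc da).
rewrite !(const_vfE hN).
rewrite subrr !mul0mx trmx0 !mulmx0 !add0r !addr0 => E.
apply: mx11_ext; apply/eqP; move: E => /eqP; rewrite mulf_eq0 invr_eq0 pnatr_eq0 /=.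
by rewrite !mxE !subr0.
Qed.

(** By J-invariance of g and J^2 = -1, g(u, Jw) = g(Ju, JJw) = -g(Ju, w). *)
Lemma comp2E_skew (q : N) : (comp2E g J q)^T = - comp2E g J q.
Proof.
have [_ _ JJ _ gs _ gJ _] := hK; rewrite /comp2E trmx_mul trmxK gs.
by rewrite -[in RHS](gJ q) -mulmxA -trmx_mul JJ linearN /= trmx1 mulmxN mulmx1 opprK.
Qed.

(** The representative of omega is skew at every [x], being congruent to a skew matrix;
    differentiation preserves this. *)
Lemma DW_skew w : (DW w)^T = - DW w.
Proof.
have E x : trmx (rep_f2 p (comp2E g J) x) = - rep_f2 p (comp2E g J) x.
  have := comp2E_skew (chart_inv p x); rewrite /rep_f2.
  move: (comp2E g J _) (transJ _ _ _) => h s hh.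
  by rewrite !trmx_mul trmxK hh mulNmx mulmxN mulmxA.
have d1 := is_diff_linear_comp trmx is_diff_comp2E.
have d2 := is_diffN is_diff_comp2E.
have d3 : is_diff x0 (fun x => trmx (rep_f2 p (comp2E g J) x)) (- DW).
  have -> : (fun x => trmx (rep_f2 p (comp2E g J) x)) = - rep_f2 p (comp2E g J).
    by apply/funext => x; rewrite E.
  exact: d2.
exact: (is_diff_unique d1 d3).
Qed.

End LocalIdentities.

(** * Differentials of the lifted tensors *)

Section LiftDifferentials.
Context {R : realType} (N : charted R) (hN : is_manifold N) (p : lift_mfd N).
Local Notation m := (mdim N).
Local Notation e := (row_mx 1%:M 0 : 'rV[R]_(1 + m)).
Local Notation P := (dpi2 N).
Local Notation x0 := (chart p p).
Local Notation y0 := (chart p.2 p.2).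

Lemma is_diff_dpi2 (W : normedModType R) (f df : 'rV[R]_m -> W) :
  is_diff y0 f df ->
  is_diff x0 (fun x : 'rV[R]_(1 + m) => f (x *m P)) (fun v => df (v *m P)).
Proof.
have dl : is_diff x0 (fun x : 'rV[R]_(1 + m) => x *m P) (fun x => x *m P).
  exact: (is_diff_linear_mx (mulmxr P) _).
have E : x0 *m P = y0 by rewrite mul_dpi2 row_mxKr.
by rewrite -E => df0; exact: is_diff_comp dl df0.
Qed.

Context (X : vfield N) (theta tau : form1 N) (J : endo N) (g : form2 N).
Context (DX : 'rV[R]_m -> 'rV[R]_m) (Dtheta Dtau : 'rV[R]_m -> 'cV[R]_m)
  (DJ Dg : 'rV[R]_m -> 'M[R]_m).
Context (dX : is_diff y0 (rep_vf p.2 X) DX) (dtheta : is_diff y0 (rep_f1 p.2 theta) Dtheta)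
  (dtau : is_diff y0 (rep_f1 p.2 tau) Dtau) (dJ : is_diff y0 (rep_endo p.2 J) DJ)
  (dg : is_diff y0 (rep_f2 p.2 g) Dg).
Let Q := P^T - tau p.2 *m e.
Let hc := manifold_compatible hN.

Let is_diff_horizontal :
  is_diff y0 (fun y => P^T - rep_f1 p.2 tau y *m e) (fun v => - (Dtau v *m e)).
Proof.
have d := is_diffB (is_diff_cst P^T y0) (is_diff_linear_comp (mulmxr e) dtau).
apply: (is_diff_eq d).
by apply/funext => v; rewrite !fctE /= sub0r.
Qed.

Lemma is_diff_vlift : is_diff x0 (rep_vf p (vlift tau X))
  (fun v => X p.2 *m - (Dtau (v *m P) *m e) + DX (v *m P) *m Q).
Proof.
have := is_diff_near (rep_vlift hN tau p X)
  (is_diff_dpi2 (is_diff_mulmx dX is_diff_horizontal)).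
by rewrite (rep_vf_center hc) (rep_f1_center hc).
Qed.

Lemma is_diff_phi : is_diff x0 (rep_endo p (phi J tau))
  (fun v => P *m J p.2 *m - (Dtau (v *m P) *m e) + P *m DJ (v *m P) *m Q).
Proof.
have dPJ := is_diff_linear_comp (mulmx P) dJ.
have := is_diff_near (rep_phi hN tau p J)
  (is_diff_dpi2 (is_diff_mulmx dPJ is_diff_horizontal)).
by rewrite /= (rep_endo_center hc) (rep_f1_center hc).
Qed.

Lemma is_diff_pull1 : is_diff x0 (rep_f1 p (pull1 theta)) (fun v => P *m Dtheta (v *m P)).
Proof.
exact: is_diff_near (rep_pull1 hN p theta)
  (is_diff_dpi2 (is_diff_linear_comp (mulmx P) dtheta)).
Qed.

Lemma is_diff_eta : is_diff x0 (rep_f1 p (eta tau)) (fun v => P *m Dtau (v *m P)).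
Proof.
have d := is_diffD (is_diff_cst e^T y0) (is_diff_linear_comp (mulmx P) dtau).
apply: (is_diff_eq (is_diff_near (rep_eta hN tau p) (is_diff_dpi2 d))).
by apply/funext => v; rewrite !fctE /= add0r.
Qed.

Lemma is_diff_pull2 :
  is_diff x0 (rep_f2 p (pull2 g)) (fun v => P *m Dg (v *m P) *m P^T).
Proof.
have d := is_diff_linear_comp (mulmxr P^T) (is_diff_linear_comp (mulmx P) dg).
exact: is_diff_near (rep_pull2 hN p g) (is_diff_dpi2 d).
Qed.

Lemma is_diff_gL : is_diff x0 (rep_f2 p (gL g tau))
  (fun v => eta tau p *m (P *m Dtau (v *m P))^T + P *m Dtau (v *m P) *m (eta tau p)^T
            + P *m Dg (v *m P) *m P^T).
Proof.
have d := is_diff_linear_comp (mulmxr P^T) (is_diff_linear_comp (mulmx P) dg).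
have d2 := is_diff_mulmx is_diff_eta (is_diff_linear_comp trmx is_diff_eta).
have := is_diff_near (rep_gL hN tau p g) (is_diffD d2 (is_diff_dpi2 d)).
by rewrite (rep_f1_center (lift_compatible hN)).
Qed.

End LiftDifferentials.

(** * Pointwise algebra of the lift *)

Section LiftAlgebra.
Context {R : realType} (N : charted R) (J : endo N) (g : form2 N) (tau : form1 N)
  (V : vfield N).
Local Notation M := (lift_mfd N).
Local Notation m := (mdim N).
Local Notation e := (row_mx 1%:M 0 : 'rV[R]_(1 + m)).
Local Notation P := (dpi2 N).
Implicit Types q : M.

Lemma horizontal_dpi2 (u : 'cV[R]_m) : (P^T - u *m e) *m P = 1%:M.
Proof. by rewrite mulmxBl dpi2T_dpi2 -mulmxA xi_dpi2 mulmx0 subr0. Qed.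

Lemma vlift_dpi2 q : vlift tau V q *m P = V q.2.
Proof.
rewrite vliftE; have E (w : 'rV[R]_m) u : w *m (P^T - u *m e) *m P = w.
  by rewrite -mulmxA horizontal_dpi2 mulmx1.
exact: E.
Qed.

Lemma horizontal_eta q : (P^T - tau q.2 *m e) *m eta tau q = 0.
Proof.
rewrite etaE mulmxDr mulmxA horizontal_dpi2 mul1mx mulmxBl dpi2T_dt -mulmxA xi_dt.
by rewrite mulmx1 sub0r addNr.
Qed.

(** The lift is horizontal, so the summand built from [eta] vanishes on it. *)
Lemma vcontract_gL : vcontract (gL g tau) (vlift tau V) = pull1 (vcontract g V).
Proof.
apply/funext => q; rewrite /vcontract /pull1 vliftE /gL /pull2.
set Q := P^T - _.
have E : V q.2 *m Q *m (eta tau q *m (eta tau q)^T + P *m g q.2 *m P^T)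
    = V q.2 *m g q.2 *m P^T.
  rewrite mulmxDr -[V _ *m Q *m _ in X in X + _]mulmxA (mulmxA Q) horizontal_eta.
  by rewrite mul0mx mulmx0 add0r !mulmxA -(mulmxA _ Q) horizontal_dpi2 mulmx1.
by rewrite [in LHS]E trmx_mul trmxK.
Qed.

Lemma comp1E_pull1_phi (theta : form1 N) :
  comp1E (pull1 theta) (phi J tau) = pull1 (comp1E theta J).
Proof.
apply/funext => q; rewrite /comp1E /pull1 phiE.
by rewrite !mulmxA -(mulmxA _ _ P) horizontal_dpi2 mulmx1.
Qed.

(** The values of [phi] are horizontal, hence killed by [eta]; only the pullback of g
    contributes. *)
Lemma fundamental_form_pull2 : fundamental_form J g tau = pull2 (comp2E g J).
Proof.
apply/funext => q; rewrite /fundamental_form /comp2E phiE /gL /pull2.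
set Q := P^T - _.
have E : (eta tau q *m (eta tau q)^T + P *m g q.2 *m P^T) *m (P *m J q.2 *m Q)^T
    = P *m (g q.2 *m (J q.2)^T) *m P^T.
  rewrite 2!trmx_mul !mulmxA mulmxDl -(mulmxA (eta _ _)) -trmx_mul horizontal_eta.
  by rewrite trmx0 mulmx0 add0r -(mulmxA _ P^T) -trmx_mul horizontal_dpi2 trmx1 mulmx1.
exact: E.
Qed.

End LiftAlgebra.

Lemma trmx11 (R : pzRingType) (A : 'M[R]_1) : A^T = A.
Proof. by apply: mx11_ext; rewrite mxE. Qed.

(** * Lie derivatives along the lift *)

Section LiftLieAlgebra.
Context {R : realType} (N : charted R).
Local Notation m := (mdim N).
Local Notation e := (row_mx 1%:M 0 : 'rV[R]_(1 + m)).
Local Notation P := (dpi2 N).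
Context (tau : 'cV[R]_m) (j g W : 'M[R]_m) (v : 'rV[R]_m).
Context (DV : 'rV[R]_m -> 'rV[R]_m) (Dtau : 'rV[R]_m -> 'cV[R]_m)
  (DJ Dg DW : 'rV[R]_m -> 'M[R]_m).
Local Notation Q := (P^T - tau *m e).
Local Notation eta := (e^T + P *m tau).
(** The derivative of the components of V^L in direction [w], as computed in [is_diff_vlift]. *)
Local Notation DVL w := (v *m - (Dtau (w *m P) *m e) + DV (w *m P) *m Q).
Context (ht : forall a c, c *m Dtau a - a *m Dtau c = 2 *: (a *m W *m c^T)).
Implicit Types a b : 'rV[R]_(1 + m).

(** The terms ending in [Q] form the horizontal lift of (L_V J)(c), which is 0. Those ending in [e]
    form 2 dtau(Jc, V) = 2 omega(Jc, V) = 2 g(c, V), where [c] is the projection of [b]. *)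
Lemma lift_lie_phi b :
  (forall w, w *m DJ v - DV (w *m j) + DV w *m j = 0) -> j *m W = g -> g^T = g ->
  b *m (P *m j *m - (Dtau (v *m Q *m P) *m e) + P *m DJ (v *m Q *m P) *m Q)
  - DVL (b *m (P *m j *m Q)) + DVL b *m (P *m j *m Q)
  = b *m (2 *: (P *m (v *m g)^T *m e)).
Proof.
move=> hJ jW gs; have QP := horizontal_dpi2 tau.
have -> : v *m Q *m P = v by rewrite -mulmxA QP mulmx1.
have -> : b *m (P *m j *m Q) *m P = b *m P *m j by rewrite -!mulmxA QP mulmx1.
have -> : DVL b *m (P *m j *m Q) = DV (b *m P) *m j *m Q.
  rewrite mulmxDl mulmxN mulNmx !mulmxA -(mulmxA _ e P) xi_dpi2 mulmx0 !mul0mx.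
  by rewrite oppr0 add0r -(mulmxA _ Q P) QP mulmx1.
rewrite mulmxDr mulmxN !mulmxN !mulmxA; set c := b *m P.
rewrite opprD opprK.
have -> : b *m (2 *: (P *m (v *m g)^T *m e)) = (2 *: (c *m j *m W *m v^T)) *m e.
  by rewrite -(mulmxA c) jW trmx_mul gs -scalemxAr -scalemxAl !mulmxA.
have -> : DV (c *m j) = c *m DJ v + DV c *m j.
  by apply/eqP; rewrite -subr_eq0 -opprB oppr_eq0 -(hJ c) addrAC.
rewrite -ht mulmxBl mulmxDl.
move: (c *m j *m _ *m e) (c *m DJ v *m Q) (_ *m Dtau (c *m j) *m e) (_ *m j *m Q).
by move=> A B C D; apply/rowP => i; rewrite !mxE; ring.
Qed.

Lemma pairing_gL a b (k : 'M[R]_m) :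
  a *m (eta *m eta^T + P *m k *m P^T) *m b^T
  = a *m eta *m (b *m eta)^T + a *m P *m k *m (b *m P)^T.
Proof. by rewrite mulmxDr mulmxDl !trmx_mul !mulmxA. Qed.

Lemma DVL_dpi2 b : DVL b *m P = DV (b *m P).
Proof.
rewrite mulmxDl mulmxN mulNmx -!mulmxA xi_dpi2 !mulmx0 oppr0 add0r.
by rewrite horizontal_dpi2 mulmx1.
Qed.

(** This is the derivative of the identity eta(V^L) = 0. *)
Lemma DVL_eta b : DVL b *m eta = - (v *m Dtau (b *m P)).
Proof.
have e1 : e *m eta = 1%:M by rewrite mulmxDr mulmxA xi_dpi2 mul0mx addr0 xi_dt.
have Q0 : Q *m eta = 0.
  rewrite mulmxBl -mulmxA e1 mulmx1 mulmxDr dpi2T_dt mulmxA dpi2T_dpi2 mul1mx.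
  by rewrite add0r subrr.
by rewrite mulmxDl mulmxN mulNmx -!mulmxA e1 Q0 mulmx1 mulmx0 addr0.
Qed.

(** The pullback of g contributes L_V g = 0. As L_{V^L} eta = 2 alpha^phi, the square of eta
    contributes twice the two mixed products, which is 4 times their symmetric product because
    [odot] carries the factor 1/2. *)
Lemma lift_lie_gL a b :
  (forall u w, u *m Dg v *m w^T + DV u *m g *m w^T + u *m g *m (DV w)^T = 0) ->
  a *m (eta *m (P *m Dtau v)^T + P *m Dtau v *m eta^T + P *m Dg v *m P^T) *m b^T
  + DVL a *m (eta *m eta^T + P *m g *m P^T) *m b^T
  + a *m (eta *m eta^T + P *m g *m P^T) *m (DVL b)^T
  = a *m (4 *: (2^-1 *: (P *m (v *m W)^T *m eta^T + eta *m (P *m (v *m W)^T)^T))) *m b^T.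
Proof.
move=> hg; rewrite !pairing_gL !DVL_eta !DVL_dpi2.
have E (w : 'cV[R]_(1 + m)) :
    a *m (w *m eta^T + eta *m w^T) *m b^T = a *m w *m (b *m eta)^T + a *m eta *m (b *m w)^T.
  by rewrite mulmxDr mulmxDl !trmx_mul !mulmxA.
have h42 : 4 * 2^-1 = 2 :> R.
  by rewrite (_ : 4 = 2 * 2) ?mulfK ?pnatr_eq0 // -natrM.
rewrite scalerA h42 -[in RHS]scalemxAr -[in RHS]scalemxAl E.
(* Read from right to left, this is L_{V^L} eta = 2 alpha^phi, evaluated on [c]. *)
have S c : 2 *: (c *m (P *m (v *m W)^T)) = c *m P *m Dtau v - v *m Dtau (c *m P).
  by rewrite ht mulmxA -[c *m P *m (v *m W)^T]trmx11 trmx_mul trmxK.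
rewrite [in RHS]scalerDr scalemxAl S scalemxAr -linearZ /= S.
have -> : a *m (eta *m (P *m Dtau v)^T + P *m Dtau v *m eta^T + P *m Dg v *m P^T) *m b^T
  = a *m P *m Dtau v *m (b *m eta)^T + a *m eta *m (b *m P *m Dtau v)^T
    + a *m P *m Dg v *m (b *m P)^T.
  by rewrite [eta *m _ + _]addrC mulmxDr mulmxDl E !trmx_mul !mulmxA.
rewrite [(_ - _)^T]linearB /= mulmxBl mulmxBr mulNmx [(- _)^T]linearN /= mulmxN.
have := hg (a *m P) (b *m P).
move: (a *m P *m Dtau v *m _) (a *m eta *m (b *m P *m _)^T) (_ *m Dg v *m _)
  (v *m _ *m _) (_ *m g *m _) (a *m eta *m (v *m _)^T) (_ *m g *m _) => A B C D F G H CFH.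
move: CFH => /(congr1 (fun Z : 'M[R]_1 => Z 0 0)); rewrite !mxE => CFH.
by apply: mx11_ext; rewrite !mxE; lra.
Qed.

(** V^L projects to V, so the Lie derivative of a pullback is the pullback of the Lie derivative. *)
Lemma lift_lie_pull2 a b :
  (forall u w, u *m DW v *m w^T + DV u *m W *m w^T + u *m W *m (DV w)^T = 0) ->
  a *m (P *m DW v *m P^T) *m b^T + DVL a *m (P *m W *m P^T) *m b^T
  + a *m (P *m W *m P^T) *m (DVL b)^T = 0.
Proof.
move=> hw; move: (DVL_dpi2 a) (DVL_dpi2 b); move: (DVL a) (DVL b) => x y hx hy.
by rewrite -[RHS](hw (a *m P) (b *m P)) -hx -hy !trmx_mul !mulmxA.
Qed.

(** Cartan's formula d(i_V omega) = L_V omega - i_V d omega in components. Skewness brings all terms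
    to five scalars, and the claim is then the invariance equation [h2] minus the closedness
    equation [h1]. *)
Lemma contraction_closed (a b : 'rV[R]_m) :
  (forall u w, u *m DW v *m w^T + DV u *m W *m w^T + u *m W *m (DV w)^T = 0) ->
  (forall u w z : 'rV[R]_m, w *m DW u *m z^T + z *m DW w *m u^T + u *m DW z *m w^T = 0) ->
  (forall w, (DW w)^T = - DW w) -> W^T = - W ->
  b *m (v *m DW a + DV a *m W)^T - a *m (v *m DW b + DV b *m W)^T = 0.
Proof.
move=> hw hc sDW sW.
have T (u c : 'rV[R]_m) : u *m c^T = c *m u^T by rewrite -[LHS]trmx11 trmx_mul trmxK.
have S1 : b *m DW a *m v^T = - (v *m DW a *m b^T).
  by rewrite -[LHS]trmx11 !trmx_mul trmxK sDW mulNmx mulmxN mulmxA.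
have S2 : a *m W *m (DV b)^T = - (DV b *m W *m a^T).
  by rewrite -[LHS]trmx11 !trmx_mul trmxK sW mulNmx mulmxN mulmxA.
have := hw a b; have := hc a b v; rewrite S1 S2 !(T _ (_ + _)) !mulmxDl.
move: (v *m DW a *m _) (v *m DW b *m _) (a *m DW v *m _) (DV a *m _ *m _) (DV b *m _ *m _).
move=> A B C D F /(congr1 (fun Z : 'M[R]_1 => Z 0 0)); rewrite !mxE => h1.
move=> /(congr1 (fun Z : 'M[R]_1 => Z 0 0)); rewrite !mxE => h2.
by apply: mx11_ext; rewrite !mxE; lra.
Qed.

End LiftLieAlgebra.

Lemma vf_smooth_near_diff (R : realType) (M : charted R) (p : M) (X : vfield M) :
  vf_smooth_near p X -> exists D, is_diff (chart p p) (rep_vf p X) D.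
Proof.
by move=> /smooth_near_differentiable/differentiableP; exists ('d (rep_vf p X) (chart p p)).
Qed.

Theorem theorem5 (R : realType) (n : nat) (N : charted R)
    (J : endo N) (g : form2 N) (tau : form1 N) (V : vfield N)
    (hN : is_manifold N) (hdim : mdim N = n.*2)
    (hK : is_kahler J g)
    (htau : f1_smooth tau) (homega : extd1_eq tau (comp2E g J))
    (hV : vf_smooth V) (hVaut : inf_automorphism J g V) :
  let M := lift_mfd N in
  let VL := vlift tau V in
  let alpha : form1 M := vcontract (gL g tau) VL in
  let alphaphi : form1 M := comp1E alpha (phi J tau) in
  [/\ lieE_eq VL (phi J tau) (fun q => 2 *: otimes alpha (xi N) q),
      lie2_eq VL (gL g tau) (fun q => 4 *: odot alphaphi (eta tau) q),
      lie2_eq VL (fundamental_form J g tau) (fun=> 0),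
      alphaphi = (fun q => - vcontract (gL g tau) (apE (phi J tau) VL) q) &
      extd1_eq alphaphi (fun=> 0)].
Proof.
move=> M VL alpha alphaphi.
have hc := manifold_compatible hN; have hL := lift_compatible hN.
have [sJ sg _ _ gs _ gJ _] := hK.
have jW q : J q *m (g q *m (J q)^T) = g q by rewrite mulmxA gJ.
have alphaE : alpha = pull1 (vcontract g V) by exact: vcontract_gL.
have alphaphiE : alphaphi = pull1 (vcontract (comp2E g J) V).
  rewrite /alphaphi alphaE comp1E_pull1_phi; congr pull1.
  by apply/funext => q; rewrite /comp1E /vcontract /comp2E mulmxA [RHS]trmx_mul trmxK.
(* Only first derivatives at the projected point enter the claims. *)
have local (p : N) : exists DV DJ Dg Dtau,
    [/\ is_diff (chart p p) (rep_vf p V) DV, is_diff (chart p p) (rep_endo p J) DJ,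
        is_diff (chart p p) (rep_f2 p g) Dg & is_diff (chart p p) (rep_f1 p tau) Dtau].
  have [DV dV] := vf_smooth_near_diff (hV p).
  have /differentiableP dJ := smooth_near_differentiable (sJ p).
  have /differentiableP dg := smooth_near_differentiable (sg p).
  have /differentiableP dt := smooth_near_differentiable (htau p).
  by do 4!eexists; split; [exact: dV|exact: dJ|exact: dg|exact: dt].
split.
- move=> p Y /vf_smooth_near_diff[DY dY].
  have [DV [DJ [Dg [Dtau [dV dJ dg dt]]]]] := local p.2.
  have [hJ _ _] := inf_automorphism_at hc dV dJ dg hK hVaut.
  have ht := dtau_at hc dt homega.
  rewrite (lieE_coord hL (is_diff_vlift hN dV dt) dY (is_diff_phi hN dt dJ)).
  rewrite /apE alphaE /otimes phiE vliftE.
  exact: (lift_lie_phi _ ht _ hJ (jW p.2) (gs p.2)).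
- move=> p X Y /vf_smooth_near_diff[DX dX] /vf_smooth_near_diff[DY dY].
  have [DV [DJ [Dg [Dtau [dV dJ dg dt]]]]] := local p.2.
  have [_ hg _] := inf_automorphism_at hc dV dJ dg hK hVaut.
  have ht := dtau_at hc dt homega.
  rewrite (lie2_coord hL (is_diff_vlift hN dV dt) dX dY (is_diff_gL hN dt dg)).
  rewrite /ap2 alphaphiE /odot /gL vlift_dpi2 !etaE.
  congr (fun_of_matrix _ 0 0).
  exact: (lift_lie_gL (tau p.2) ht _ _ hg).
- move=> p X Y /vf_smooth_near_diff[DX dX] /vf_smooth_near_diff[DY dY].
  have [DV [DJ [Dg [Dtau [dV dJ dg dt]]]]] := local p.2.
  have [_ _ hw] := inf_automorphism_at hc dV dJ dg hK hVaut.
  rewrite fundamental_form_pull2.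
  rewrite (lie2_coord hL (is_diff_vlift hN dV dt) dX dY
    (is_diff_pull2 hN (is_diff_comp2E hc dJ dg))).
  rewrite vlift_dpi2 /ap2 mulmx0 mul0mx; congr (fun_of_matrix _ 0 0).
  exact: (lift_lie_pull2 _ _ _ _ hw).
- rewrite alphaphiE /VL phi_vlift vcontract_gL; apply/funext => q.
  rewrite /pull1 -mulmxN; congr (_ *m _).
  rewrite /vcontract /apE -linearN /=; congr (_^T).
  (* J is skew with respect to g, whence the minus sign in alpha^phi = -g^L(phi V^L, .). *)
  have E : J q.2 *m g q.2 = - (g q.2 *m (J q.2)^T).
    by have := comp2E_skew hK q.2; rewrite /comp2E trmx_mul trmxK gs.
  by rewrite -mulmxA E mulmxN opprK.
- move=> p X Y /vf_smooth_near_diff[DX dX] /vf_smooth_near_diff[DY dY].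
  have [DV [DJ [Dg [Dtau [dV dJ dg dt]]]]] := local p.2.
  have [_ _ hw] := inf_automorphism_at hc dV dJ dg hK hVaut.
  have dW := is_diff_comp2E hc dJ dg.
  (* The Leibniz rule differentiates i_V omega, whose pullback is alpha^phi. *)
  have db := is_diff_near (rep_vcontract hc p.2 (comp2E g J) V)
     (is_diff_linear_comp trmx (is_diff_mulmx dV dW)).
  rewrite (rep_vf_center hc) (rep_f2_center hc) in db.
  rewrite alphaphiE (extd1_coord hL dX dY (is_diff_pull1 hN db)).
  rewrite /ap2 mulmx0 mul0mx [RHS]mxE -[RHS](mulr0 2^-1); congr (_ * _).
  have hcl := closed_at hc dJ dg hK.
  have hskew := DW_skew hc dJ dg hK.
  (* Closedness is checked downstairs, on the projections of the two test vectors. *)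
  have E := contraction_closed (X p *m dpi2 N) (Y p *m dpi2 N)
    hw hcl hskew (comp2E_skew hK p.2).
  apply: etrans (_ : (0 : 'M[R]_1) 0 0 = 0); last by rewrite mxE.
  congr (fun_of_matrix _ 0 0); rewrite -[RHS]E.
  by congr (_ - _); exact: mulmxA.
Qed.
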